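(* Let $\kappa$ be a regular uncountable cardinal. Then there exists a totally disconnected compactum $X$ such that $Nt(X)=\kappa$ and $X$ has a $P_\kappa$-point.
   Context: A compactum is a compact Hausdorff space. Families of open sets are ordered by inclusion; a family is $\mu^{\mathrm{op}}$-like if no member is contained in $\mu$-many members; $Nt(X)$ is the least $\mu\geq\omega$ such that $X$ has a $\mu^{\mathrm{op}}$-like base. A point $p\in X$ is a $P_\kappa$-point if for every family $\mathcal{A}$ of fewer than $\kappa$ neighborhoods of $p$, $p$ lies in the interior of $\bigcap\mathcal{A}$. *)

(* Defs.v *)
(* Cardinals are represented by types / sets,
   compared with mathcomp-classical's cardinality relation [#<=]. *)
From HB Require Import structures.
From mathcomp Require Import all_boot all_order.
From mathcomp Require Import all_classical.
From mathcomp Require Import topology.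
Set Implicit Arguments. Unset Strict Implicit. Unset Printing Implicit Defensive.
Local Open Scope classical_set_scope.
Local Open Scope card_scope.

Definition card_lt T U (A : set T) (B : set U) := A #<= B /\ ~ (B #<= A).

Definition uncountable_card (K : Type) := ~ countable [set: K].

(* The cardinal |K| is regular: it is not the union of fewer than |K|
   sets each of cardinality less than |K| (index sets of size < |K| are
   represented as subsets of K). *)
Definition regular_card (K : Type) :=
  forall (I : set K) (F : K -> set K),
    card_lt I [set: K] -> (forall i, I i -> card_lt (F i) [set: K]) ->
    ~ (\bigcup_(i in I) F i = [set: K]).

Definition is_base (X : topologicalType) (B : set (set X)) :=
  (forall b, B b -> open b) /\
  (forall U : set X, open U ->
     exists F : set (set X), F `<=` B /\ U = \bigcup_(V in F) V).

Definition op_like (X : topologicalType) (B : set (set X)) T (mu : set T) :=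
  forall b, B b -> card_lt [set b' | B b' /\ b `<=` b'] mu.

(* Nt(X) = |K|, for |K| infinite: X has a |K|^op-like base, and for no
   infinite cardinal mu < |K| does X have a mu^op-like base. *)
Definition Nt_eq (X : topologicalType) (K : Type) :=
  (exists B : set (set X), is_base B /\ op_like B [set: K]) /\
  (forall mu : set K, infinite_set mu -> card_lt mu [set: K] ->
     ~ (exists B : set (set X), is_base B /\ op_like B mu)).

Definition P_point (X : topologicalType) (K : Type) (p : X) :=
  forall A : set (set X), card_lt A [set: K] ->
    (forall N, A N -> nbhs p N) -> nbhs p (\bigcap_(N in A) N).

(* Main.v *)
(* Fix a total order on K, all of whose strict initial segments have fewer than
   |K| elements, and let X be the space of functions f : K -> {None, Some 0,
   Some 1} such that the set where f = None is an initial segment containing a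
   fixed point k0, with the topology of pointwise convergence.

   The constant function None is a non-isolated P_|K|-point: its basic
   neighbourhoods are the sets {f t = None}, which decrease with t, and by
   regularity fewer than |K| elements of K are bounded. Hence it belongs to at
   least |K| members of any base, and if mu < |K|, then some mu of these
   contain a common base member, so no base is mu^op-like.

   The base of nonempty boxes {f t = None, f = Some g on the finite set F} is
   |K|^op-like: choose x in such a box and c with x c <> None. If a box given by
   (u, G, h) contains the first one, then u < c because x u = None, and G is a
   subset of F because the values Some _ of x outside F can be flipped
   independently. So there are fewer than |K| choices for u and, for each u,
   finitely many boxes. *)
Require Import Defs.
From HB Require Import structures.
From mathcomp Require Import all_boot all_order.
From mathcomp Require Import finmap wochoice.
From mathcomp Require Import all_classical.
From mathcomp Require Import topology.
Local Open Scope classical_set_scope.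
Set Implicit Arguments. Unset Strict Implicit. Unset Printing Implicit Defensive.
Local Open Scope card_scope.

(** * Comparison of cardinals and regularity *)

Lemma card_le_rel T U (A : set T) (B : set U) (G : T -> U -> Prop) :
  (forall a, A a -> exists2 b, B b & G a b) ->
  (forall a a' b, G a b -> G a' b -> a = a') -> A #<= B.
Proof.
move=> tot inj; have [->|/set0P[a0 Aa0]] := eqVneq A set0; first exact: card_ge0.
have [b0 _ _] := tot _ Aa0.
have /choice[f fP] a : exists b, A a -> B b /\ G a b.
  have [Aa|nAa] := pselect (A a); last by exists b0.
  by have [b Bb Gab] := tot a Aa; exists b.
suff /injfunPex[h] : exists2 f : T -> U, set_fun A B f & set_inj A f by exact: inj_card_le.
exists f => [a /fP[]//|a a' /set_mem/fP[_ Ga] /set_mem/fP[_ Ga'] eqf].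
by apply: inj Ga _; rewrite eqf.
Qed.

Lemma card_le_inj T U (A : set T) (B : set U) (a0 : T) : A #<= B -> A a0 ->
  exists2 f : T -> U, set_fun A B f & set_inj A f.
Proof.
elim/Ppointed: U => U in B *; last by move=> /pcard_leP/injfunPex.
by have -> : B = set0 by [apply/seteqP; split=> // x; case: (no x)]; rewrite card_le0 => /eqP->.
Qed.

Lemma card_le_total T U (A : set T) (B : set U) : A #<= B \/ B #<= A.
Proof.
pose P := [set G : set (T * U) | [/\ G `<=` A `*` B,
  forall a b b', G (a, b) -> G (a, b') -> b = b' &
  forall a a' b, G (a, b) -> G (a', b) -> a = a']].
have [F FP tF|G [[GAB Gfun Ginj] Gmax]] := @Zorn_bigcup _ P.
  have common u v : (\bigcup_(X in F) X) u -> (\bigcup_(X in F) X) v ->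
      exists X, [/\ P X, X u & X v].
    move=> [X FX Xu] [Y FY Yv]; have [XY|YX] := tF _ _ FX FY.
      by exists Y; split; [exact: FP|exact: XY|].
    by exists X; split; [exact: FP| |exact: YX].
  split.
  - by move=> u [X /FP[XAB _ _] /XAB].
  - by move=> a b b' /common h /h[X [[_ Xf _] /Xf]]; exact.
  - by move=> a a' b /common h /h[X [[_ _ Xi] /Xi]]; exact.
have [[a Aa na]|domA] := pselect (exists2 a, A a & forall b, ~ G (a, b)); last first.
  left; apply: (@card_le_rel _ _ _ _ (fun a b => G (a, b))) => // a Aa.
  apply: contrapT => nb; apply: domA; exists a => // b Gab; apply: nb.
  by exists b => //; have [] := GAB _ Gab.
have [[b Bb nb]|codomB] := pselect (exists2 b, B b & forall a, ~ G (a, b)); last first.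
  right; apply: (@card_le_rel _ _ _ _ (fun b a => G (a, b))) => [b Bb|b b' a']; last exact: Gfun.
  apply: contrapT => nb; apply: codomB; exists b => // a' Gab; apply: nb.
  by exists a' => //; have [] := GAB _ Gab.
exfalso; apply: (Gmax (G `|` [set (a, b)])).
  split=> [u|]; first by left.
  by move/(_ (a, b)) => h; apply: (na b); apply: h; right.
split=> [u [/GAB//|->//]|a1 b1 b2|a1 a2 b1].
- move=> [G1|/pair_equal_spec[e1 ->]] [G2|/pair_equal_spec[e2 ->]] //.
  + exact: Gfun G1 G2.
  + by case: (na b1); rewrite -e2.
  + by case: (na b2); rewrite -e1.
- move=> [G1|/pair_equal_spec[-> e1]] [G2|/pair_equal_spec[-> e2]] //.
  + exact: Ginj G1 G2.
  + by case: (nb a1); rewrite -e2.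
  + by case: (nb a2); rewrite -e1.
Qed.

Lemma card_ltNge T U (A : set T) (B : set U) : card_lt A B <-> ~ (B #<= A).
Proof. by split=> [[]//|nBA]; split=> //; have [|/nBA] := card_le_total A B. Qed.

Lemma card_lt_finite T (K : Type) (A : set T) :
  infinite_set [set: K] -> finite_set A -> card_lt A [set: K].
Proof. by move=> Kinf Afin; apply/card_ltNge => /card_le_finite/(_ Afin). Qed.

(** If [S] had at least |K| elements, pulling the sets [F i] back along an injection of [K] into [S]
    would cover [K] by fewer than |K| finite sets. *)
Lemma regular_card_bigcup_finite V (K : Type) (I : set K) (F : K -> set V) (S : set V) :
  infinite_set [set: K] -> regular_card K -> card_lt I [set: K] ->
  (forall i, I i -> finite_set (F i)) -> S `<=` \bigcup_(i in I) F i ->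
  card_lt S [set: K].
Proof.
move=> Kinf Kreg Ilt Ffin SF; apply/card_ltNge => KS.
have [k0 _] : [set: K] !=set0.
  by apply/set0P/eqP => K0; apply: Kinf; rewrite K0; exact: finite_set0.
have [h hS hinj] := card_le_inj KS (Logic.I : [set: K] k0).
apply: (Kreg I (fun i => h @^-1` F i) Ilt) => [i Ii|].
  apply: card_lt_finite => //; apply: finite_preimage; last exact: Ffin.
  by move=> x y _ _ e; apply: hinj e; rewrite inE.
apply/seteqP; split=> // k _; have [i Ii Fi] := SF _ (hS k Logic.I).
by exists i.
Qed.

(** * Well orders with small initial segments *)

Lemma well_order_total (T : eqType) (R : rel T) : well_order R -> total R.
Proof. by move=> /withinW/(@wo_chainW _ _ predT) tot x y; exact: tot. Qed.

Lemma well_order_anti (T : eqType) (R : rel T) :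
  well_order R -> antisymmetric R.
Proof.
by move=> /withinW/(@wo_chain_antisymmetric _ _ predT) anti x y; exact: anti.
Qed.

Lemma well_order_trans (T : eqType) (R : rel T) : well_order R -> transitive R.
Proof.
move=> wo y x z xy yz; have tot := well_order_total wo.
have anti := well_order_anti wo.
(* Transitivity is read off from the least element of {x, y, z}. *)
have [|u [[uin ulb] _]] := wo [pred u | [|| u == x, u == y | u == z]].
  by exists x; rewrite inE eqxx.
have ux : R u x by apply: ulb; rewrite !inE eqxx.
have uy : R u y by apply: ulb; rewrite !inE eqxx orbT.
have uz : R u z by apply: ulb; rewrite !inE eqxx !orbT.
move: uin; rewrite inE => /or3P[]/eqP uE; subst u => //.
- by have -> : x = y by apply: anti; rewrite xy ux.
- by have <- : y = z by apply: anti; rewrite yz uy.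
Qed.

(* The strict initial segment below [a] is [[set y | ~~ R a y]]. *)
Lemma initial_well_order (K : choiceType) : exists R : rel K,
  [/\ total R, transitive R, antisymmetric R &
      forall a, card_lt [set y | ~~ R a y] [set: K]].
Proof.
have [R wo] := well_ordering_principle K.
have tot := well_order_total wo; have tr := well_order_trans wo.
have anti := well_order_anti wo.
have [small|big] := pselect (forall a, card_lt [set y | ~~ R a y] [set: K]).
  by exists R.
have [a0 Pa0] : exists a, [set: K] #<= [set y | ~~ R a y].
  apply: contrapT => nex; apply: big => a; apply/card_ltNge => Ka.
  by apply: nex; exists a.
(* Take the least [x] with |K| elements strictly below it and pull [R] back along an injection [h]
   of [K] into that segment. A large segment below [a] in the new order would make the one below
   [h a] large, although [h a] is strictly below [x]. *)
have [|x [[xP xlb] _]] := wo [pred a | `[< [set: K] #<= [set y | ~~ R a y] >]].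
  by exists a0; apply/asboolP.
move: xP => /asboolP Kx; have [h hx hinj] := card_le_inj (a0 := x) Kx I.
have {}hinj : injective h by move=> u v e; apply: hinj e; rewrite inE.
exists (fun a b => R (h a) (h b)); split=> [a b|b a c|a b /anti/hinj//|a].
- exact: tot.
- exact: tr.
apply/card_ltNge => Ka.
have : ~~ R x (h a) := hx a I.
move/negP; apply; apply: xlb; apply/asboolP.
apply: card_le_trans Ka _.
apply: (@card_ge_preimage _ _ [set y | ~~ R (h a) y] h).
by move=> u v _ _; exact: hinj.
Qed.

(** * The space of labellings and its topology *)

Definition labelling (K : choiceType) (R : rel K) (k0 : K) : Type :=
  {f : K -> option bool |
    f k0 = None /\ forall x y, R x y -> f y = None -> f x = None}.

Section LabellingTopology.
Variables (K : choiceType) (R : rel K) (k0 : K).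
Local Notation X := (labelling R k0).

Definition lab (f : X) : K -> option bool := sval f.
Local Coercion lab : labelling >-> Funclass.

Lemma lab_k0 (f : X) : f k0 = None.
Proof. by case: f => f []. Qed.

Lemma lab_down (f : X) x y : R x y -> f y = None -> f x = None.
Proof. by case: f => f [? fd]; exact: fd. Qed.

Lemma lab_ext (f g : X) : (forall a, f a = g a) -> f = g.
Proof. by case: f g => [f fP] [g gP] /= /funext fg; exact: eq_exist. Qed.

HB.instance Definition _ := gen_eqMixin X.
HB.instance Definition _ := gen_choiceMixin X.

Definition lab_open : set_system X := [set U | forall x : X, U x ->
  exists F : {fset K}, forall y : X, (forall c, c \in F -> y c = x c) -> U y].

Lemma lab_openT : lab_open setT.
Proof. by move=> x _; exists fset0. Qed.

Lemma lab_openI : setI_closed lab_open.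
Proof.
move=> U V Uo Vo x [/Uo[F FU] /Vo[G GV]]; exists (F `|` G)%fset => y yFG.
by split; [apply: FU|apply: GV] => c cF; apply: yFG; rewrite in_fsetU cF ?orbT.
Qed.

Lemma lab_open_bigU (I : Type) (f : I -> set X) :
  (forall i, lab_open (f i)) -> lab_open (\bigcup_i f i).
Proof.
move=> fo x [i _ /(fo i)[F FU]]; exists F => y /FU fy.
by exists i.
Qed.

HB.instance Definition _ :=
  isOpenTopological.Build X lab_openT lab_openI lab_open_bigU.

Lemma lab_openE (U : set X) : open U = lab_open U.
Proof. by []. Qed.

Lemma lab_nbhs (x : X) (N : set X) : nbhs x N ->
  exists F : {fset K}, forall y : X, (forall c, c \in F -> y c = x c) -> N y.
Proof.
rewrite nbhsE => -[B [+ Bx] BN]; rewrite lab_openE => /(_ _ Bx)[F FB].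
by exists F => y /FB/BN.
Qed.

Lemma lab_open_coord (a : K) (P : set (option bool)) :
  open [set x : X | P (x a)].
Proof.
rewrite lab_openE => x Px; exists [fset a]%fset => y /(_ a) yx /=.
by rewrite yx ?in_fset1.
Qed.

Lemma lab_clopen_coord (a : K) (P : set (option bool)) :
  clopen [set x : X | P (x a)].
Proof.
split; first exact: lab_open_coord.
rewrite -[Y in closed Y]setCK; apply: open_closedC.
exact: (@lab_open_coord a (~` P)).
Qed.

Lemma lab_neq (x y : X) : x <> y -> exists a, x a <> y a.
Proof.
move=> xy; apply: contrapT => h; apply/xy/lab_ext => a.
by apply: contrapT => n; apply: h; exists a.
Qed.

Lemma lab_totally_disconnected : totally_disconnected [set: X].
Proof.
apply: zero_dimension_totally_disconnected => x y /eqP/lab_neq[a xya].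
exists [set z : X | [set lab x a] (z a)]; split=> //; last by move=> /= /esym.
exact: lab_clopen_coord.
Qed.

Lemma lab_hausdorff : hausdorff_space X.
Proof.
move=> x y xy; apply: contrapT => /lab_neq[a]; apply.
have n (z : X) : nbhs z [set u : X | [set z a] (u a)].
  by apply: open_nbhs_nbhs; split=> //; exact: lab_open_coord.
by have [z [/= <- <-]] := xy _ _ (n x) (n y).
Qed.

(** An ultrafilter selects one of the three values at each coordinate, and these values form its
    limit. The limit is a labelling because each defining condition involves at most two
    coordinates, on which some actual labelling agrees with it. *)
Lemma lab_compact : compact [set: X].
Proof.
rewrite compact_ultra => F FU _.
have FF : ProperFilter F := ultra_proper.
have /choice[f fP] a : exists v, F [set x : X | x a = v].
  have [|FN] := in_ultra_setVsetC [set x : X | x a = None] FU.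
    by exists None.
  have [|FT] := in_ultra_setVsetC [set x : X | x a = Some true] FU.
    by exists (Some true).
  exists (Some false); apply: filterS (filterI FN FT) => x [/=].
  by case: (x a) => // -[].
have fX : f k0 = None /\ forall x y, R x y -> f y = None -> f x = None.
  split=> [|x y Rxy fy].
    by have [z /= <-] := filter_ex (fP k0); exact: lab_k0.
  have [z [/= <- zy]] := filter_ex (filterI (fP x) (fP y)).
  by apply: lab_down Rxy _; rewrite zy.
exists (exist _ f fX); split=> // N /lab_nbhs[G GN].
suff : F [set x : X | forall c, c \in enum_fset G -> x c = f c].
  by apply: filterS => x xG; exact: GN.
elim: (enum_fset G) => [|c s IH]; first by apply: filterS filterT => x _ c.
apply: filterS (filterI (fP c) IH) => x [/= xc xs] d.
by rewrite in_cons => /predU1P[->//|/xs].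
Qed.

End LabellingTopology.
Coercion lab : labelling >-> Funclass.

(** * The P-point and the value of Nt *)

Section LabellingNt.
Variables (K : choiceType) (R : rel K) (k0 : K).
Hypotheses (Rtot : total R) (Rtrans : transitive R) (Ranti : antisymmetric R).
Hypothesis Rsmall : forall a, card_lt [set y | ~~ R a y] [set: K].
Hypotheses (Kinf : infinite_set [set: K]) (Kreg : regular_card K).
Local Notation X := (labelling R k0).

Let Rxx x : R x x.
Proof. by have := Rtot x x; rewrite orbb. Qed.

Lemma order_no_max m : exists c, ~~ R c m.
Proof.
apply: contrapT => nc.
have mmax c : R c m by apply: contrapT => /negP cm; apply: nc; exists c.
have cE c : ~~ R m c \/ c = m.
  by case: (boolP (R m c)) => mc; [right; apply: Ranti; rewrite mmax mc|left].
(* A maximum [m] would make [K] the union of the pairs {i, m} with [i] strictly below [m]. These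
   cover [m] only if some such [i] exists, so the empty segment is treated apart. *)
have [I0|/set0P[i0 Ii0]] := eqVneq [set y | ~~ R m y] set0.
  apply: Kinf; apply: sub_finite_set (finite_set1 m) => c _ /=.
  by have [mc|//] := cE c; have : [set y | ~~ R m y] c by []; rewrite I0.
suff /card_ltNge : card_lt [set: K] [set: K] by apply; exact: card_lexx.
apply: (@regular_card_bigcup_finite _ _ _ (fun i => [set i; m]) _
          Kinf Kreg (Rsmall m)).
  by move=> i _; exact: finite_set2.
move=> c _; have [mc|->] := cE c; first by exists c => //; left.
by exists i0 => //; right.
Qed.

(** Finitely many conditions with value [None] reduce to one, at the largest coordinate concerned.
    If there are none, [k0] serves. *)
Lemma lab_None_max (x : X) (F : {fset K}) : exists2 t, x t = None &
  forall c, c \in F -> x c = None -> R c t.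
Proof.
suff [t xt tP] : exists2 t, x t = None &
    forall c, c \in enum_fset F -> x c = None -> R c t by exists t.
elim: (enum_fset F) => [|a s [t xt tP]]; first by exists k0 => //; exact: lab_k0.
case xa: (x a) => [b|].
  by exists t => // c; rewrite in_cons => /predU1P[->|/tP//]; rewrite xa.
have [at_|ta] := orP (Rtot a t).
  by exists t => // c; rewrite in_cons => /predU1P[->|/tP].
exists a => // c; rewrite in_cons => /predU1P[->//|/tP ct /ct Rct].
exact: Rtrans Rct ta.
Qed.

Definition lab_top : X :=
  exist _ (fun=> None) (conj erefl (fun _ _ _ _ => erefl)).

Lemma nbhs_lab_top (N : set X) : nbhs lab_top N ->
  exists a, forall y : X, y a = None -> N y.
Proof.
move=> /lab_nbhs[F FN]; have [t _ tP] := lab_None_max lab_top F.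
by exists t => y yt; apply: FN => c cF /=; apply: lab_down yt; exact: tP.
Qed.

Lemma lab_top_P_point : P_point K lab_top.
Proof.
move=> A Alt AN.
have /choice[a aP] N : exists a, A N -> forall y : X, y a = None -> N y.
  have [/AN/nbhs_lab_top[a aN]|nA] := pselect (A N); first by exists a.
  by exists k0.
have Ilt : card_lt (a @` A) [set: K].
  apply/card_ltNge => KI; case/card_ltNge: Alt.
  exact: card_le_trans KI (card_image_le _ _).
(* Were the set of all [a N] unbounded, the strict initial segments below its elements would cover
   [K], against regularity. *)
have [b bP] : exists b, forall N, A N -> R (a N) b.
  apply: contrapT => nb; apply: (Kreg Ilt (fun i _ => Rsmall i)).
  apply/seteqP; split=> // b _; apply: contrapT => h; apply: nb.
  exists b => N AN'; apply: contrapT => /negP ab; apply: h.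
  by exists (a N) => //; exists N.
apply: (@filterS _ _ _ [set y : X | [set None] (y b)]) => [y /= yb N AN'|].
  by apply: aP => //; apply: lab_down yb; exact: bP.
by apply: open_nbhs_nbhs; split=> //; exact: lab_open_coord.
Qed.

Lemma lab_not_top t : exists x : X, x t = None /\ exists c, x c <> None.
Proof.
(* With [m] the larger of [t] and [k0], the labelling that is [None] exactly up to [m] is [None] at
   both, and it takes another value beyond [m]. *)
have [m [tm km]] : exists m, R t m /\ R k0 m.
  by have [tk|kt] := orP (Rtot t k0); [exists k0|exists t].
have [c cm] := order_no_max m.
pose f x := if R x m then None else Some true.
have fX : f k0 = None /\ forall x y, R x y -> f y = None -> f x = None.
  rewrite /f; split=> [|x y xy]; first by rewrite km.
  by case: ifP => // ym _; rewrite (Rtrans xy ym).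
exists (exist _ f fX) => /=; rewrite /f tm; split=> //.
by exists c; rewrite (negbTE cm).
Qed.

Lemma lab_no_small_op_base T (mu : set T) (B : set (set X)) :
  card_lt mu [set: K] -> is_base B -> ~ op_like B mu.
Proof.
move=> mult [Bo Bb] opB.
have atop (U : set X) : open U -> U lab_top ->
    exists2 b, B b /\ b lab_top & b `<=` U.
  move=> /Bb[F [FB ->]] [b Fb bt]; exists b; first by split=> //; exact: FB.
  exact: bigcup_sup.
pose A := [set b | B b /\ b lab_top].
have AN N : A N -> nbhs lab_top N.
  by move=> [/Bo No Nt]; exact: open_nbhs_nbhs.
(* If [A] were smaller, its intersection would contain all labellings that are [None] at some [a],
   among them an [x] with [x c] not [None]. But some member of [A] lies inside the set where the
   value at [c] is [None]. *)
have KA : [set: K] #<= A.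
  apply: contrapT => /card_ltNge Alt.
  have [a aP] := nbhs_lab_top (lab_top_P_point Alt AN).
  have [x [xa [c xc]]] := lab_not_top a.
  have [|//|b [Bb' bt] bU] := @atop [set y : X | [set None] (y c)].
    exact: lab_open_coord.
  by apply/xc/bU; apply: (aP x xa b); split.
have muA := card_le_trans mult.1 KA.
have [mu0|/set0P[m0 mum0]] := eqVneq mu set0.
  have [b [Bb' _] _] := atop setT openT Logic.I.
  by have /card_ltNge := opB _ Bb'; apply; rewrite mu0.
have [j jA jinj] := card_le_inj muA mum0.
have jlt : card_lt (j @` mu) [set: K].
  apply/card_ltNge => KI; case/card_ltNge: mult.
  exact: card_le_trans KI (card_image_le _ _).
have jN N : (j @` mu) N -> nbhs lab_top N.
  by move=> [m mum <-]; exact/AN/jA.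
(* The mu chosen members of [A] intersect in a neighbourhood of [lab_top], so a base member [b]
   inside it has mu supersets in [B]. *)
have := lab_top_P_point jlt jN; rewrite nbhsE => -[V [Vo Vt] VN].
have [b [Bb' bt] bV] := atop _ Vo Vt.
have /card_ltNge := opB _ Bb'; apply.
have /card_esym/card_eqPle[+ _] := inj_card_eq jinj.
move=> /card_le_trans; apply; apply: subset_card_le => _ [m mum <-] /=.
split; first by have [] := jA _ mum.
by move=> x /bV/VN; apply; exists m.
Qed.

(** One coordinate [t] carries all the [None] conditions, since [None] propagates downwards. Only
    the values of [g] on [F] matter. *)
Definition lab_box (t : K) (F : {fset K}) (g : K -> bool) : set X :=
  [set x | x t = None /\ forall c, c \in F -> x c = Some (g c)].

(** Nonemptiness keeps out the empty set, which every member would contain. *)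
Definition lab_base : set (set X) :=
  [set b | b !=set0 /\ exists t F g, b = lab_box t F g].

Lemma lab_base_is_base : is_base lab_base.
Proof.
split=> [_ [_ [t [F [g ->]]]]|U].
  rewrite lab_openE => x [xt xF]; exists (t |` F)%fset => y yx; split.
    by rewrite yx ?fset1U1.
  by move=> c cF; rewrite yx ?xF // fset1Ur.
rewrite lab_openE => Uo; exists [set b | lab_base b /\ b `<=` U].
split=> [b []//|].
apply/seteqP; split=> [x Ux|x [b [_ bU] /bU//]].
have [F FU] := Uo _ Ux; have [t xt tP] := lab_None_max x F.
(* The coordinates of [F] where [x] is [None] are controlled by [t]. On the remaining ones [x] is
   [Some _], so the default [false] is never read. *)
pose b := lab_box t [fset c in F | lab x c != None]%fset
                  (fun c => odflt false (lab x c)).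
have bx : b x.
  by split=> // c; rewrite !inE /= => /andP[_]; case: (lab x c).
exists b => //; split; first by split; [exists x|do 3 eexists].
move=> y [yt yF]; apply: FU => c cF; case xc: (lab x c) => [v|].
  by rewrite yF ?xc // !inE /= cF xc.
by apply: lab_down yt; exact: tP.
Qed.

Lemma lab_base_not_top b :
  lab_base b -> exists2 x : X, b x & exists c, x c <> None.
Proof.
move=> [[x bx] [t [F [g bE]]]].
(* If [x] is [None] everywhere, then [F] is empty, and any labelling that is [None] at [t] lies in
   the box. *)
have [xc|nx] := pselect (exists c, x c <> None); first by exists x.
have [y [yt yc]] := lab_not_top t; exists y => //.
rewrite bE in bx *; split=> // c cF; case: nx; exists c.
by rewrite bx.2.
Qed.

(** Negating a value [Some _] leaves the set of [None] coordinates unchanged, so the result is again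
    a labelling. *)
Lemma lab_box_flip t F g (x : X) c :
  lab_box t F g x -> x c <> None -> c \notin F ->
  exists2 y, lab_box t F g y & y c <> x c.
Proof.
move=> [xt xF] xc cF.
pose f a := if a == c then omap negb (x c) else x a.
have fE a : x a = None -> f a = None by rewrite /f; case: eqP => // ->.
have fX : f k0 = None /\ forall a b, R a b -> f b = None -> f a = None.
  split=> [|a b ab]; first exact/fE/lab_k0.
  rewrite {1}/f; case: eqP => [_|_ xb]; first by case: (x c) xc.
  exact/fE/(lab_down ab).
exists (exist _ f fX) => /=; last by rewrite /f eqxx; case: (x c) xc => // -[].
split=> /=; first exact: fE.
move=> a aF; rewrite /f; case: eqP => [ac|_]; last exact: xF.
by rewrite -ac aF in cF.
Qed.

Lemma lab_base_op_like : op_like lab_base [set: K].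
Proof.
move=> b bB; have [x bx [c xc]] := lab_base_not_top bB.
have [_ [t [F [g bE]]]] := bB.
(* A box (u, G, h) containing [b] contains [x], so [h] agrees with [x'] on [G] and the box is
   determined by [u] and [G] alone. *)
pose x' a := odflt false (lab x a).
apply: (@regular_card_bigcup_finite _ _ [set u | ~~ R c u]
  (fun u => [set lab_box u G x' | G in [set` fpowerset F]]) _
  Kinf Kreg (Rsmall c)).
  by move=> u _; apply: finite_image; exact: finite_fset.
move=> b' [[_ [u [G [h b'E]]]] bb']; exists u.
  apply/negP => cu; apply: xc; apply: lab_down cu _.
  by have := bb' _ bx; rewrite b'E => -[].
have := bb' _ bx; rewrite b'E => -[xu xG]; exists G.
  rewrite /= fpowersetE; apply/fsubsetP => d dG.
  apply: contrapT => /negP dF.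
  have xd : x d <> None by rewrite xG.
  have [|y yb] := @lab_box_flip t F g x d _ xd dF; first by rewrite -bE.
  rewrite -bE in yb; have := bb' _ yb; rewrite b'E => -[_ yG].
  by apply; rewrite yG // xG.
by apply/seteqP; split=> y [yu yG]; split=> // d dG; rewrite yG // /x' xG.
Qed.

Lemma lab_Nt : Nt_eq X K.
Proof.
split.
  exists lab_base; split; [exact: lab_base_is_base|exact: lab_base_op_like].
by move=> mu _ mult [B [Bb]]; exact: lab_no_small_op_base.
Qed.

End LabellingNt.

Theorem theorem3p38 (K : Type) :
  uncountable_card K -> regular_card K ->
  exists X : topologicalType,
    [/\ compact [set: X], hausdorff_space X, totally_disconnected [set: X],
        Nt_eq X K & exists p : X, P_point K p].
Proof.
move=> Kunc Kreg.
have Kinf : infinite_set [set: {classic K}].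
  by move=> /finite_set_countable.
have [k0 _] : [set: {classic K}] !=set0.
  by apply/set0P/eqP => K0; apply: Kinf; rewrite K0; exact: finite_set0.
have [R [Rtot Rtrans Ranti Rsmall]] := initial_well_order {classic K}.
exists (labelling R k0); split.
- exact: lab_compact.
- exact: lab_hausdorff.
- exact: lab_totally_disconnected.
- exact: lab_Nt.
- by exists (lab_top R k0); exact: lab_top_P_point.
Qed.
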